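(* Let $T$ be a tree with $n$ vertices and odd diameter $d\geq 3$, and let $\rho=\varepsilon_1(T)$. Then $$\rho\leq \max\Big\{\varepsilon_1(D_{n,d}^{0, n-d-1}),\ \varepsilon_1(D_{n,d}^{\lfloor\frac{n-d-1}{2}\rfloor, \lceil\frac{n-d-1}{2}\rceil})\Big\},$$ with equality only if $T\cong D_{n,d}^{0, n-d-1}$ or $T\cong D_{n,d}^{\lfloor\frac{n-d-1}{2}\rfloor, \lceil\frac{n-d-1}{2}\rceil}$. In particular, $D_{n,3}^{\lfloor \frac{n-4}{2}\rfloor, \lceil \frac{n-4}{2}\rceil}$ is the unique tree maximizing $\varepsilon_1$ among all trees with $n$ vertices and diameter $3$.
   Context: All graphs are finite, simple and connected. For a graph $G$, $d_G(u,v)$ is the distance and $e_G(u)=\max_{v} d_G(u,v)$ the eccentricity. The eccentricity matrix $\varepsilon(G)$ is the symmetric matrix indexed by $V(G)$ with $(\varepsilon(G))_{uv}=d_G(u,v)$ if $d_G(u,v)=\min\{e_G(u),e_G(v)\}$ and $(\varepsilon(G))_{uv}=0$ otherwise; $\varepsilon_1(G)$ denotes its largest eigenvalue. For odd $d\geq 3$ and integers $b\geq a\geq 0$ with $a+b=n-d-1$, $D_{n,d}^{a,b}$ is the tree obtained from the path $v_0v_1\cdots v_d$ by attaching $a$ pendant vertices to $v_1$ and $b$ pendant vertices to $v_{d-1}$. *)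

(* Defs.v *)
From mathcomp Require Import all_boot all_order all_algebra.
From mathcomp Require Import sesquilinear spectral polyrcf complex.
From mathcomp Require Import classical_sets reals.
Import ComplexField.
Local Open Scope sesquilinear_scope.
Set Implicit Arguments.
Unset Strict Implicit.
Unset Printing Implicit Defensive.
Import Order.TTheory GRing.Theory Num.Theory.
Local Open Scope ring_scope.

Record sgraph := SGraph {
  vertex :> finType;
  adj : rel vertex;
  adj_sym : symmetric adj;
  adj_irr : irreflexive adj }.

Definition giso (G H : sgraph) : Prop :=
  exists2 f : G -> H, bijective f & forall u v, adj (f u) (f v) = adj u v.

(* The length of a shortest walk from u to v; its junk value, when v is not   *)
(* reachable from u, is #|G|.                                                 *)
Definition dist (G : sgraph) (u v : G) : nat :=
  find (fun k => [exists p : k.-tuple G, path (@adj G) u p && (last u p == v)])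
       (iota 0 #|G|).

Definition ecc (G : sgraph) (u : G) : nat := (\max_(v : G) dist u v)%N.

Definition diam (G : sgraph) : nat := (\max_(u : G) ecc u)%N.

Definition connected (G : sgraph) : Prop :=
  forall u v : G, connect (@adj G) u v.

(* For adj symmetric, u :: v :: nil is always an adj-cycle, whence the bound  *)
(* on size c.                                                                 *)
Definition acyclic (G : sgraph) : Prop :=
  forall c : seq G, (2 < size c)%N -> ~ ucycle (@adj G) c.

Definition is_tree (G : sgraph) : Prop := connected G /\ acyclic G.

Definition ecc_mx (R : realType) (G : sgraph) : 'M[R]_#|G| :=
  \matrix_(i, j)
    let u := enum_val i in let v := enum_val j in
    if dist u v == minn (ecc u) (ecc v) then (dist u v)%:R else 0.

(* The set of eigenvalues is finite, and nonempty when G is nonempty as the   *)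
(* matrix is symmetric: the supremum is a maximum, see eps1P.                 *)
Definition eps1 (R : realType) (G : sgraph) : R :=
  sup [set x | eigenvalue (ecc_mx R G) x]%classic.

(* The vertices of the double broom: inl i is the path vertex v_i,            *)
(* inr (inl _) are the a pendant vertices attached to v_1, and inr (inr _)    *)
(* the b pendant vertices attached to v_(d-1).                                *)
Definition broom_vertex (d a b : nat) : finType :=
  ('I_d.+1 + ('I_a + 'I_b))%type.

Definition broom_adj (d a b : nat) (x y : broom_vertex d a b) : bool :=
  match x, y with
  | inl i, inl j => (i.+1 == j) || (j.+1 == i)
  | inl i, inr (inl _) | inr (inl _), inl i => i == 1%N :> nat
  | inl i, inr (inr _) | inr (inr _), inl i => i == d.-1 :> nat
  | inr _, inr _ => false
  end.

Lemma broom_adj_sym d a b : symmetric (@broom_adj d a b).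
Proof. by move=> [i|[i|i]] [j|[j|j]] //=; rewrite orbC. Qed.

Lemma broom_adj_irr d a b : irreflexive (@broom_adj d a b).
Proof. by move=> [i|[i|i]] //=; rewrite orbb -[RHS](ltnn i) eqn_leq ltnn. Qed.

(* D_{n,d}^{a,b}; the number of vertices n = d + 1 + a + b is left implicit.  *)
Definition broom (d a b : nat) : sgraph :=
  SGraph (@broom_adj_sym d a b) (@broom_adj_irr d a b).

Lemma dist_sym (G : sgraph) (u v : G) : dist u v = dist v u.
Proof.
suff H (x y : G) k : [exists p : k.-tuple G, path (@adj G) x p && (last x p == y)]
  -> [exists p : k.-tuple G, path (@adj G) y p && (last y p == x)].
  by apply: eq_find => k; apply/idP/idP; apply: H.
case/existsP=> p /andP[px /eqP lxy].
have sz : size (rev (belast x p)) == k by rewrite size_rev size_belast size_tuple.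
apply/existsP; exists (Tuple sz) => /=; rewrite -lxy.
rewrite (@eq_path _ _ (fun z => (@adj G)^~ z)); last by move=> a b; rewrite adj_sym.
rewrite rev_path px /=; case: (val p) => //= a s.
by rewrite rev_cons last_rcons.
Qed.

Lemma ecc_mx_sym (R : realType) (G : sgraph) : (ecc_mx R G)^T = ecc_mx R G.
Proof. by apply/matrixP=> i j; rewrite !mxE /= dist_sym minnC. Qed.

Lemma eigenvalue_sym (R : rcfType) n (A : 'M[R]_n) :
  (0 < n)%N -> A^T = A -> exists x, eigenvalue A x.
Proof.
move=> n0 symA; pose Ac := map_mx (real_complex R) A.
have [a aP] := eigenvalue_closed Ac n0.
have [v vA v0] := eigenvalueP aP.
have dE (w : 'rV[R[i]]_n) : w != 0 -> (w *m w^t*) 0 0 != 0.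
  move=> w0; apply: contra w0; rewrite mxE => /eqP s0.
  have H i : true -> 0 <= w 0 i * w^t* i 0 by rewrite !mxE mul_conjC_ge0.
  apply/eqP/rowP=> i; have Hi : w 0 i * w^t* i 0 = 0 by apply: (psumr_eq0P H s0).
  by move/eqP: Hi; rewrite !mxE mul_conjC_eq0 => /eqP.
have AcH : Ac^t* = Ac.
  apply/matrixP=> i j; rewrite !mxE -{1}symA mxE conj_Creal//.
  by apply/complex_realP; eexists.
have ar : a^* = a.
  have E1 : v *m Ac *m v^t* = a *: (v *m v^t*) by rewrite vA scalemxAl.
  have E2 : v *m Ac *m v^t* = a^* *: (v *m v^t*).
    have : (v *m Ac)^t* = (a *: v)^t* by rewrite vA.
    rewrite trmx_mul map_mxM AcH linearZ /= map_mxZ => E.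
    by rewrite -mulmxA E -scalemxAr.
  have : a *: (v *m v^t*) = a^* *: (v *m v^t*) by rewrite -E1 E2.
  move/matrixP/(_ 0 0); rewrite 2!(mxE scalemx_key) => /(mulIf (dE v v0)) /esym.
  exact.
have ra : a = real_complex R (complex.Re a).
  by have /CrealP/complex_realP[k ->] := ar.
exists (complex.Re a).
by move: aP; rewrite ra !eigenvalue_root_char -map_char_poly fmorph_root.
Qed.

Lemma seq_max (R : realDomainType) (x : R) (s : seq R) :
  exists2 m, m \in x :: s & forall y, y \in x :: s -> y <= m.
Proof.
elim: s x => [|y s IHs] x.
  by exists x => [|y]; rewrite ?mem_head// inE => /eqP->.
have [m ms mub] := IHs y; exists (Num.max x m).
  by rewrite inE; case: leP => _; rewrite ?eqxx // ms orbT.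
by move=> z; rewrite le_max inE => /orP[/eqP->|/mub->]; rewrite ?lexx ?orbT.
Qed.

Lemma eps1P (R : realType) (G : sgraph) : (0 < #|G|)%N ->
  eigenvalue (ecc_mx R G) (eps1 R G) /\
  forall x, eigenvalue (ecc_mx R G) x -> x <= eps1 R G.
Proof.
move=> G0; set A := ecc_mx R G.
have [x0 x0P] := eigenvalue_sym G0 (ecc_mx_sym R G).
pose s := rootsR (char_poly A).
have sE x : (x \in s) = eigenvalue A x.
  rewrite eigenvalue_root_char -(roots_on_rootsR _ x) ?itv_boundlr//=.
  by rewrite monic_neq0// char_poly_monic.
have [m mP mub] : exists2 m, eigenvalue A m & forall x, eigenvalue A x -> x <= m.
  have [m] := seq_max x0 s.
  have -> : (m \in x0 :: s) = eigenvalue A m.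
    by rewrite inE sE; case: eqP => // ->; rewrite x0P.
  by move=> mP mub; exists m => // x xP; apply: mub; rewrite inE sE xP orbT.
have -> // : eps1 R G = m.
apply/eqP; rewrite eq_le; apply/andP; split.
  by apply: ge_sup; [exists m|move=> x /mub].
by apply: ub_le_sup => //; exists m => x /mub.
Qed.

(* Main.v *)
(* A tree of diameter d = 2r+1 is centred at an edge.  Give each vertex its side
   and its depth h <= r with respect to this edge.  The entry of the eccentricity
   matrix at (x, y) is h x + h y + 1 if x and y lie on opposite sides and one of
   them has depth r, and 0 otherwise.  Let p, q be the numbers of vertices of
   depth r on the two sides and S, S' the sums of (h x + r + 1)^2 over the other
   vertices of the two sides.  Solving for a positive eigenvector that is constant
   on levels shows that lam = eps1^2 is the largest root of
     (lam - p S') (lam - q S) = p q d^2 lam.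
   Moving a superfluous vertex of depth < r to depth r increases lam strictly,
   which leaves the brooms, where S = S' = s is the sum of k^2 for r < k <= 2r and
   p + q is fixed.  There the equation is affine in p q with slope
   s^2 - d^2 lam, so the extremal values of p q are optimal; the slope cannot
   vanish, since that would mean s = (p + q) d^2, which divisibility by 2r+1
   excludes. *)
Require Import Defs.
From mathcomp Require Import all_boot all_order all_algebra.
From mathcomp Require Import reals.
From mathcomp Require Import zify ring lra.
Set Implicit Arguments.
Unset Strict Implicit.
Unset Printing Implicit Defensive.
Import Order.TTheory GRing.Theory Num.Theory.
Local Open Scope ring_scope.

(** * Walks and graph distance *)

Section Distance.
Variable G : sgraph.
Implicit Types (u v w : G) (k l : nat).

Definition walk k u v :=
  [exists p : k.-tuple G, path (@adj G) u p && (last u p == v)].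

Lemma walkP k u v :
  reflect (exists p : seq G, [/\ size p = k, path (@adj G) u p & last u p = v])
          (walk k u v).
Proof.
apply: (iffP existsP) => [[p /andP[pp /eqP lp]]|[p [sp pp lp]]].
  by exists p; rewrite size_tuple.
by exists (Tuple (introT eqP sp)); rewrite /= pp lp eqxx.
Qed.

Lemma walk0 u : walk 0 u u.
Proof. by apply/walkP; exists [::]. Qed.

Lemma walk1 u v : adj u v -> walk 1 u v.
Proof. by move=> uv; apply/walkP; exists [:: v]; split=> //=; rewrite uv. Qed.

Lemma walk1_adj u v : walk 1 u v -> adj u v.
Proof. by case/walkP=> -[|x [|? ?]] [] //= _ /andP[ux _] <-. Qed.

Lemma walk0_eq u v : walk 0 u v -> u = v.
Proof. by case/walkP=> -[|? ?] [] //. Qed.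

Lemma walk_cat k l u v w : walk k u v -> walk l v w -> walk (k + l) u w.
Proof.
case/walkP=> p [sp pp lp] /walkP[q [sq pq lq]]; apply/walkP; exists (p ++ q).
by rewrite size_cat sp sq cat_path last_cat lp pp pq lq.
Qed.

Lemma walk_split k l u w :
  walk (k + l) u w -> exists2 v, walk k u v & walk l v w.
Proof.
case/walkP=> p [sp pp lp]; exists (last u (take k p)).
  apply/walkP; exists (take k p); split=> //.
    by rewrite size_takel // sp leq_addr.
  by move: pp; rewrite -{1}(cat_take_drop k p) cat_path => /andP[].
apply/walkP; exists (drop k p); split.
- by rewrite size_drop sp addKn.
- by move: pp; rewrite -{1}(cat_take_drop k p) cat_path => /andP[].
- by rewrite -last_cat cat_take_drop.
Qed.

Lemma dist_le k u v : walk k u v -> (dist u v <= k)%N.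
Proof.
move=> kuv; rewrite leqNgt; apply/negP => lt_k.
have := lt_k; rewrite /dist => /(before_find 0%N).
rewrite nth_iota ?add0n; last first.
  by rewrite (leq_trans lt_k) // (leq_trans (find_size _ _)) // size_iota.
by rewrite -/(walk k u v) kuv.
Qed.

Lemma dist_leq_card u v : (dist u v <= #|G|)%N.
Proof. by rewrite (leq_trans (find_size _ _)) // size_iota. Qed.

Lemma walk_dist_lt u v : (dist u v < #|G|)%N -> walk (dist u v) u v.
Proof.
move=> lt_d; have : has (fun k => walk k u v) (iota 0 #|G|).
  by rewrite has_find size_iota.
by move/(nth_find 0%N); rewrite nth_iota.
Qed.

(** A walk shortens to a duplicate-free path, whose length is below [#|G|], so the search defining
    [dist] succeeds. *)
Lemma walk_dist u v : connect (@adj G) u v -> walk (dist u v) u v.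
Proof.
case/connectP=> p0 pp ->; case/shortenP: pp => p pp up _.
apply: walk_dist_lt; have /dist_le le_d : walk (size p) u (last u p).
  by apply/walkP; exists p.
apply: leq_ltn_trans le_d _.
by have := card_uniqP up => /= <-; apply: max_card.
Qed.

(** Unreachable pairs do no harm: their value [#|G|] bounds every distance. *)
Lemma dist_triangle v u w : (dist u w <= dist u v + dist v w)%N.
Proof.
have [uv|uv] := ltnP (dist u v) #|G|; last first.
  by rewrite (leq_trans (dist_leq_card u w)) // (leq_trans uv) ?leq_addr.
have [vw|vw] := ltnP (dist v w) #|G|; last first.
  by rewrite (leq_trans (dist_leq_card u w)) // (leq_trans vw) ?leq_addl.
exact: dist_le (walk_cat (walk_dist_lt uv) (walk_dist_lt vw)).
Qed.

Lemma dist_xx u : dist u u = 0%N.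
Proof. by apply/eqP; rewrite -leqn0 dist_le ?walk0. Qed.

Lemma dist_adj u v : adj u v -> (dist u v <= 1)%N.
Proof. by move=> uv; rewrite dist_le ?walk1. Qed.

Lemma dist_le_diam u v : (dist u v <= diam G)%N.
Proof.
rewrite /diam; apply: (leq_trans _ (leq_bigmax u)).
by rewrite /ecc (leq_bigmax v).
Qed.

Lemma diam_attained : (0 < diam G)%N -> exists u v, dist u v = diam G.
Proof.
move=> d0; have G0 : (0 < #|G|)%N.
  rewrite lt0n; apply: contraTneq d0 => /card0_eq G0.
  by rewrite -leqNgt /diam; apply/bigmax_leqP => u; have := G0 u; rewrite inE.
have [u du] := @bigop.eq_bigmax _ (@ecc G) G0; have [v dv] := @bigop.eq_bigmax
  _ (dist u) G0.
by exists u, v; rewrite /diam du /ecc dv.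
Qed.

End Distance.

(** * Edges of an acyclic graph are bridges *)

Section Bridge.
Variable G : sgraph.
Implicit Types x y a b : G.

Definition adj_but x y a b :=
  adj a b && ~~ ((a == x) && (b == y) || (a == y) && (b == x)).

(* A shortest path from [x] to [y] avoiding the edge [xy] would close up to a
   cycle through that edge. *)
Lemma acyclic_bridge x y : acyclic G -> adj x y -> ~~ connect (adj_but x y) x y.
Proof.
move=> acG xy; apply/negP=> /connectP[p0 pp ly].
case/shortenP: pp ly => p pp up _ ly.
apply: (acG (x :: p)) => /=.
  case: p pp up ly => [|z [|t p]] //=.
    by move=> _ _ yx; rewrite yx adj_irr in xy.
  by move=> /andP[+ _] _ zy; rewrite /adj_but zy !eqxx /= andbF.
apply/andP; split=> //; rewrite /= rcons_path -ly adj_sym xy andbT.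
by apply: sub_path pp => a b /andP[].
Qed.

Lemma adj_but_sym x y : symmetric (adj_but x y).
Proof. by move=> a b; rewrite /adj_but adj_sym orbC ![(b == _) && _]andbC. Qed.

End Bridge.

(* A tree rooted at an edge: [h] is the distance to the edge, [sd] tells which
   end of the edge is nearer, and [par] exchanges the two ends, which are the
   vertices of depth [0]. *)
Record edge_rooted (G : sgraph) (par : G -> G) (sd : G -> bool) (h : G -> nat) :
    Prop := EdgeRooted {
  er_adj : forall x y, adj x y = (par x == y) || (par y == x);
  er_h : forall x, h (par x) = (h x).-1;
  er_sd : forall x, sd (par x) = (h x == 0%N) (+) sd x;
  er_root : forall x y, h x = 0%N -> h y = 0%N -> sd x = sd y -> x = y }.

(** * Distances, connectedness and acyclicity of edge-rooted graphs *)

Section EdgeRooted.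
Variables (G : sgraph) (par : G -> G) (sd : G -> bool) (h : G -> nat).
Hypothesis erG : edge_rooted par sd h.
Implicit Types x y z : G.

Lemma er_adj_par x : adj x (par x).
Proof. by rewrite (er_adj erG) eqxx. Qed.

Lemma er_h_iter k x : h (iter k par x) = (h x - k)%N.
Proof. by elim: k => [|k IH] /=; rewrite ?subn0 // (er_h erG) IH subnS. Qed.

Lemma er_sd_iter k x : (k <= h x)%N -> sd (iter k par x) = sd x.
Proof.
elim: k => [|k IH] //= lt_k; rewrite (er_sd erG) er_h_iter IH ?(ltnW lt_k) //.
by rewrite subn_eq0 leqNgt lt_k.
Qed.

Lemma er_root_par x : h x = 0%N -> par (par x) = x.
Proof.
move=> hx; apply: (er_root erG); rewrite ?(er_h erG) ?hx //.
by rewrite !(er_sd erG) (er_h erG) hx /= negbK.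
Qed.

Lemma dist_iter k x : (dist x (iter k par x) <= k)%N.
Proof.
elim: k => [|k IH]; first by rewrite dist_xx.
apply: leq_trans (dist_triangle (iter k par x) _ _) _.
by rewrite -[X in (_ <= X)%N]addn1 leq_add // dist_adj ?er_adj_par.
Qed.

Lemma dist_same_side x y : sd x = sd y -> (dist x y <= h x + h y)%N.
Proof.
move=> sxy; apply: leq_trans (dist_triangle (iter (h x) par x) _ _) _.
rewrite leq_add ?dist_iter //.
suff -> : iter (h x) par x = iter (h y) par y by rewrite dist_sym dist_iter.
by apply: (er_root erG); rewrite ?er_h_iter ?subnn // !er_sd_iter.
Qed.

Lemma dist_other_side_le x y : sd x != sd y -> (dist x y <= h x + h y + 1)%N.
Proof.
move=> sxy; pose z := iter (h x) par x.
have hz : h z = 0%N by rewrite er_h_iter subnn.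
apply: leq_trans (dist_triangle z _ _) _.
rewrite -addnA leq_add ?dist_iter //.
apply: leq_trans (dist_triangle (par z) _ _) _.
rewrite addnC leq_add ?dist_adj ?er_adj_par //.
have := @dist_same_side (par z) y; rewrite (er_h erG) hz; apply.
by rewrite (er_sd erG) hz er_sd_iter //; case: (sd x) sxy; case: (sd y).
Qed.

Lemma er_adjP x y : adj x y ->
  sd x = sd y /\ (h x = (h y).+1 \/ h y = (h x).+1) \/
  [/\ sd x = ~~ sd y, h x = 0%N & h y = 0%N].
Proof.
wlog: x y / par x = y => [wl|xy _].
  rewrite {1}(er_adj erG) => /orP[/eqP xy|/eqP yx].
    by apply: wl => //; rewrite -xy er_adj_par.
  have yx' : adj y x by rewrite -yx er_adj_par.
  case: (wl y x yx yx') => [[-> [->|->]]|[-> -> ->]].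
  - by left; split; [|right].
  - by left; split; [|left].
  - by right; rewrite negbK.
rewrite -xy (er_sd erG) (er_h erG); case: (posnP (h x)) => [->|hx] /=.
  by right; rewrite negbK.
by left; split; [case: (h x) hx|left; lia].
Qed.

(** Sides change only between the two vertices of depth 0, and depth varies by one otherwise; a walk
    that changes sides must descend, cross and climb. *)
Lemma walk_bound k x y : walk k x y ->
  if sd x == sd y then (h x <= h y + k)%N && (h y <= h x + k)%N
  else (h x + h y + 1 <= k)%N.
Proof.
case/walkP=> p [<-]; elim: p x {k} => [|z p IH] x /=.
  by move=> _ ->; rewrite eqxx; lia.
case/andP=> xz pz lz; have := IH z pz lz.
have [[-> [->|hz]]|[-> -> ->]] := er_adjP xz; last by case: (sd z); case: (sd
  y) => /=; lia.
- by case: ifP; lia.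
- by rewrite hz; case: ifP; lia.
Qed.

Lemma er_connect_par x : connect (@adj G) x (par x).
Proof. by rewrite connect1 ?er_adj_par. Qed.

Lemma er_connected : connected G.
Proof.
have symG := sym_connect_sym (@adj_sym G).
have ci k x : connect (@adj G) x (iter k par x).
  by elim: k => //= k IH; apply: connect_trans IH (er_connect_par _).
have cr x y : h x = 0%N -> h y = 0%N -> connect (@adj G) x y.
  move=> hx hy; have [sxy|sxy] := eqVneq (sd x) (sd y).
    by rewrite (er_root erG hx hy sxy).
  rewrite -(@er_root _ _ _ _ erG (par x) y) ?er_connect_par ?(er_h erG) ?hx //.
  by rewrite (er_sd erG) hx; case: (sd x) sxy; case: (sd y).
move=> x y; apply: connect_trans (ci (h x) x) _.
rewrite symG; apply: connect_trans (ci (h y) y) _.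
by apply: cr; rewrite er_h_iter subnn.
Qed.

Lemma dist_other_side x y : sd x != sd y -> dist x y = (h x + h y + 1)%N.
Proof.
move=> sxy; apply/eqP; rewrite eqn_leq dist_other_side_le //=.
by have := walk_bound (walk_dist (er_connected x y)); rewrite (negPf sxy).
Qed.

(** A deepest vertex of a cycle has only its parent as a neighbour there, so its successor and
    predecessor coincide, which fails for length above 2. *)
Lemma er_acyclic : acyclic G.
Proof.
move=> c sc /andP[cc uc].
have [z0 z0c] : exists z, z \in c by case: c sc {cc uc} => // z c _; exists z;
  rewrite mem_head.
case: (arg_maxnP (P := [in c]) h z0c) => z zc zmax.
have nbr w : w \in c -> adj z w -> w = par z.
  move=> wc; rewrite (er_adj erG) => /orP[/eqP //|/eqP wz].
  have [hw|hw] := posnP (h w); first by rewrite -wz er_root_par.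
  by have := zmax w wc; have := er_h erG w; rewrite wz; lia.
have nz : next c z = par z.
  by apply: nbr; rewrite ?mem_next //; have := next_cycle cc zc.
have pz : prev c z = par z.
  by apply: nbr; rewrite ?mem_prev // adj_sym; have := prev_cycle cc zc.
case/rot_to: zc => i s rs.
have us : uniq (z :: s) by rewrite -rs rot_uniq.
have ss : (2 < size (z :: s))%N by rewrite -rs size_rot.
move: nz pz; rewrite -(next_rot i uc) -(prev_rot i uc) rs.
case: s {rs} us ss => [|a [|b s]] // us _.
have zs : z \notin [:: a, b & s] by case/andP: us.
rewrite next_nth prev_nth mem_head (memNindex zs) index_head /= => <-.
rewrite -[size s]/(size (b :: s)).-1 nth_last /= => ls.
by move: us; rewrite /= -{2}ls mem_last andbF.
Qed.

End EdgeRooted.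

(** * Rooting a tree at one of its edges *)

Section TreeIsEdgeRooted.
Variables (T : sgraph) (c0 c1 : T).
Hypotheses (conT : connected T) (acT : acyclic T) (c01 : adj c0 c1).
Implicit Types x y z : T.

Definition edge_depth x := minn (dist x c0) (dist x c1).

Let h := edge_depth.

(** The default [x] never occurs: in a connected graph some neighbour is closer to the edge. *)
Definition edge_parent x : T :=
  if x == c0 then c1 else if x == c1 then c0
  else odflt x [pick y | adj x y && ((h y).+1 == h x)].

Let par := edge_parent.

(** Climbing to the edge, rather than comparing distances, makes the side invariant under taking
    parents. *)
Definition edge_side x := iter (edge_depth x) edge_parent x == c1.

Let sd := edge_side.

Let c10 : c1 != c0.
Proof. by apply: contraTneq c01 => ->; rewrite adj_irr. Qed.

Let h_eq0 x : h x = 0%N -> x = c0 \/ x = c1.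
Proof.
move=> /eqP; rewrite /h /edge_depth -leqn0 geq_min !leqn0 => /orP[]/eqP d0; [left|right];
by apply: walk0_eq; rewrite -d0 walk_dist.
Qed.

Let h_c0 : h c0 = 0%N.
Proof. by rewrite /h /edge_depth dist_xx min0n. Qed.

Let h_c1 : h c1 = 0%N.
Proof. by rewrite /h /edge_depth dist_xx minn0. Qed.

Let h_adj x y : adj x y -> (h x <= (h y).+1)%N.
Proof.
move=> /dist_adj xy; rewrite /h /edge_depth.
by have := dist_triangle y x c0; have := dist_triangle y x c1; lia.
Qed.

Let pickP x : x != c0 -> x != c1 -> adj x (par x) /\ (h (par x)).+1 = h x.
Proof.
move=> x0 x1; rewrite /par /edge_parent (negPf x0) (negPf x1).
case: pickP => [y /andP[xy /eqP //]|no]; exfalso.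
have hx : (0 < h x)%N.
  by rewrite lt0n; apply/eqP => /h_eq0[] xc; rewrite xc eqxx in x0 x1.
suff [y xy hy] : exists2 y, adj x y & (h y < h x)%N.
  by have := no y; rewrite xy /= => /eqP; have := h_adj xy; lia.
(* Let [c] be the end nearer to [x]; the first step of a shortest walk from [x] to [c] lowers
   [h]. *)
have [c dc hc] : exists2 c, h x = dist x c & forall y, (h y <= dist y c)%N.
  have [le|/ltnW le] := leqP (dist x c0) (dist x c1).
    by exists c0 => [|y]; rewrite /h /edge_depth ?geq_minl //; apply/minn_idPl.
  by exists c1 => [|y]; rewrite /h /edge_depth ?geq_minr //; apply/minn_idPr.
have := walk_dist (conT x c); rewrite -dc -(prednK hx) -add1n.
case/walk_split=> y /walk1_adj xy /dist_le yc; exists y => //.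
by have := hc y; lia.
Qed.

Let adj_par x : adj x (par x).
Proof.
have [->|x0] := eqVneq x c0; first by rewrite /par /edge_parent eqxx.
have [->|x1] := eqVneq x c1; last by have [] := pickP x0 x1.
by rewrite /par /edge_parent eqxx (negPf c10) adj_sym.
Qed.

Let h_par x : h (par x) = (h x).-1.
Proof.
have [->|x0] := eqVneq x c0; first by rewrite /par /edge_parent eqxx h_c0 h_c1.
have [->|x1] := eqVneq x c1; last by have [_ <-] := pickP x0 x1.
by rewrite /par /edge_parent eqxx (negPf c10) h_c0 h_c1.
Qed.

Let h_iter x k : h (iter k par x) = (h x - k)%N.
Proof. by elim: k => [|k IH] /=; rewrite ?subn0 // h_par IH subnS. Qed.

(* Were [xy] not a parent edge, every vertex could still reach [c0] along
   parent edges avoiding [xy], against [acyclic_bridge]. *)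
Let adj_parE x y : adj x y = (par x == y) || (par y == x).
Proof.
apply/idP/orP => [xy|[]/eqP<-]; rewrite ?[adj (par _) _]adj_sym //.
have [yx|yx] := eqVneq (par y) x; [by right|left].
apply: contraNT (acyclic_bridge acT xy) => nxy.
have symc := sym_connect_sym (adj_but_sym x y).
have cp z : connect (adj_but x y) z (par z).
  apply: connect1; rewrite /adj_but adj_par negb_or /=; apply/andP; split.
    by apply: contraNN nxy => /andP[/eqP<-].
  by apply: contraNN yx => /andP[/eqP<-].
have cc0 z : connect (adj_but x y) z c0.
  have ci k : connect (adj_but x y) z (iter k par z).
    by elim: k => //= k IH; apply: connect_trans IH (cp _).
  have [|<- //|zc1] := @h_eq0 (iter (h z) par z); first by rewrite h_iter subnn.
  apply: connect_trans (ci (h z)) _; rewrite zc1.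
  by have := cp c1; rewrite /par /edge_parent eqxx (negPf c10).
by apply: connect_trans (cc0 x) _; rewrite symc.
Qed.

Lemma tree_edge_rooted : edge_rooted par sd h.
Proof.
have sd0 : sd c0 = false by rewrite /sd /edge_side -/h -/par h_c0 eq_sym (negPf c10).
have sd1 : sd c1 = true by rewrite /sd /edge_side -/h -/par h_c1 /= eqxx.
split=> [x y|x|x|x y].
- exact: adj_parE.
- exact: h_par.
- have [hx|hx] := posnP (h x) => /=; last first.
    by rewrite /sd /edge_side -/h -/par h_par -iterSr prednK.
  case: (h_eq0 hx) => ->; rewrite /par /edge_parent eqxx ?(negPf c10) ?sd0 ?sd1 //.
- by move=> /h_eq0[->|->] /h_eq0[->|->] //; rewrite sd0 sd1.
Qed.

End TreeIsEdgeRooted.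

(** * Trees of odd diameter and the entries of their eccentricity matrix *)

Definition balanced (G : sgraph) (r : nat) (sd : G -> bool) (h : G -> nat) :=
  (forall x, (h x <= r)%N) /\ (forall b, exists2 x, sd x = b & h x = r).

(** The root is the middle edge of a diametral path from [u] to [v]. A vertex [x] is at distance
    [h x + r + 1] from whichever of [u], [v] lies opposite, so the diameter bounds its depth. *)
Lemma odd_diam_tree (T : sgraph) r : is_tree T -> diam T = r.*2.+1 ->
  exists par sd h, @edge_rooted T par sd h /\ balanced r sd h.
Proof.
move=> [conT acT] dT; have [|u [v]] := @diam_attained T; first by rewrite dT.
rewrite dT => duv; have := walk_dist (conT u v).
have -> : dist u v = (r + (1 + r))%N by lia.
case/walk_split=> c0 uc0 /walk_split[c1 /walk1_adj c01 c1v].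
have er := tree_edge_rooted conT acT c01.
move: uc0 c1v => /dist_le uc0 /dist_le c1v.
have c0v := dist_triangle c0 u v; have c1u := dist_triangle c1 u v.
have c01v := dist_triangle c1 c0 v; have c01u := dist_triangle c0 u c1.
have d01 := dist_adj c01.
move: er; set par := edge_parent _ _; set h := edge_depth _ _.
set sd := edge_side _ _ => er.
have hc0 : h c0 = 0%N by rewrite /h /edge_depth dist_xx min0n.
have hc1 : h c1 = 0%N by rewrite /h /edge_depth dist_xx minn0.
have c10 : c1 != c0 by apply: contraTneq c01 => ->; rewrite adj_irr.
have sd0 : sd c0 = false by rewrite /sd /edge_side -/h hc0 /= eq_sym (negPf c10).
have sd1 : sd c1 = true by rewrite /sd /edge_side -/h hc1 /= eqxx.
have hu : h u = r by rewrite /h /edge_depth; lia.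
have hv : h v = r by rewrite /h /edge_depth ![dist v _]dist_sym; lia.
(* On the side of [c1], [u] would be at distance [r + 1] from [c0]. *)
have su : sd u = false.
  apply/negbTE/negP => su; have := dist_other_side er (x := u) (y := c0).
  by rewrite su sd0 => /(_ isT); lia.
have sv : sd v = true.
  apply: contraT => /negPf sv; have := dist_other_side er (x := c1) (y := v).
  by rewrite sv sd1 => /(_ isT); lia.
exists par, sd, h; split=> //; split=> [x|[]]; [|by exists v|by exists u].
have [sx|sx] := boolP (sd x).
  have := dist_other_side er (x := x) (y := u); have := dist_le_diam x u.
  by rewrite sx su dT => ? /(_ isT); lia.
have := dist_other_side er (x := x) (y := v); have := dist_le_diam x v.
by rewrite (negPf sx) sv dT => ? /(_ isT); lia.
Qed.

Section Balanced.
Variables (G : sgraph) (r : nat).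
Variables (par : G -> G) (sd : G -> bool) (h : G -> nat).
Hypotheses (erG : edge_rooted par sd h) (balG : balanced r sd h).
Implicit Types x y : G.

Let hle x : (h x <= r)%N := proj1 balG x.

Lemma balanced_ecc x : ecc x = (h x + r + 1)%N.
Proof.
apply/eqP; rewrite eqn_leq; apply/andP; split.
  apply/bigmax_leqP => y _; have hy := hle y.
  have [sxy|sxy] := eqVneq (sd x) (sd y); last by rewrite (dist_other_side erG sxy); lia.
  by have := dist_same_side erG sxy; lia.
have [y sy hy] := proj2 balG (~~ sd x).
have <- : dist x y = (h x + r + 1)%N.
  by rewrite -hy; apply: (dist_other_side erG); rewrite sy; case: (sd x).
exact: leq_bigmax.
Qed.

Lemma balanced_diam : diam G = r.*2.+1.
Proof.
apply/eqP; rewrite eqn_leq; apply/andP; split.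
  by apply/bigmax_leqP => x _; rewrite balanced_ecc; have := hle x; lia.
have [x _ hx] := proj2 balG true.
have -> : r.*2.+1 = ecc x by rewrite balanced_ecc hx; lia.
exact: leq_bigmax.
Qed.

(** Eccentricities are [h x + r + 1]. Distances within a side stay below both of them; across,
    [h x + h y + 1] equals the smaller one exactly when the larger depth is [r]. *)
Lemma balanced_entry x y :
  (if dist x y == minn (ecc x) (ecc y) then dist x y else 0) =
  (if (sd x != sd y) && ((h x == r) || (h y == r)) then h x + h y + 1 else 0)%N.
Proof.
have hx := hle x; have hy := hle y.
rewrite !balanced_ecc; have [sxy|sxy] /= := eqVneq (sd x) (sd y).
  by case: eqP => //; have := dist_same_side erG sxy; lia.
rewrite (dist_other_side erG sxy); case: ifP; case: ifP => //; lia.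
Qed.

End Balanced.

(** * A positive eigenvector belongs to the largest eigenvalue *)

Section Perron.
Variables (R : realType) (G : sgraph).

Lemma ecc_mxE i j : ecc_mx R G i j =
  (let x := enum_val i in let y := enum_val j in
   if dist x y == minn (ecc x) (ecc y) then dist x y else 0)%:R.
Proof. by rewrite mxE /=; case: ifP. Qed.

(** Perron's argument: for an eigenvector [u] of [eps1], the equation at an index maximising
    [|u i| / w i] gives [eps1 <= rho], while [rho] is itself an eigenvalue. *)
Lemma eps1_positive_vector (w : G -> R) (rho : R) :
  (0 < #|G|)%N -> (forall x, 0 < w x) ->
  (forall y, \sum_x w x *
     (if dist x y == minn (ecc x) (ecc y) then dist x y else 0)%:R = rho * w y) ->
  eps1 R G = rho.
Proof.
move=> G0 w0 wE; have [epsP epsM] := eps1P R G0.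
pose v : 'rV[R]_#|G| := \row_i w (enum_val i).
have vA : v *m ecc_mx R G = rho *: v.
  apply/rowP => j; rewrite !mxE -wE (reindex_onto (@enum_val _ G) enum_rank) /=.
    by apply: eq_big => [i|i _]; rewrite ?enum_valK ?eqxx // ecc_mxE mxE.
  by move=> x _; rewrite enum_rankK.
have v0 i : 0 < v 0 i by rewrite mxE.
have A0 i j : 0 <= ecc_mx R G i j by rewrite ecc_mxE.
pose i0 : 'I_#|G| := Ordinal G0.
apply/eqP; rewrite eq_le epsM; last first.
  apply/eigenvalueP; exists v => //.
  by apply/eqP => /rowP/(_ i0) vi; have := v0 i0; rewrite vi mxE ltxx.
case/eigenvalueP: epsP => u uA u0; rewrite andbT.
case: (arg_maxP (fun i => `|u 0 i| / v 0 i) (erefl : xpredT i0)) => m _ mmax.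
have um : 0 < `|u 0 m|.
  rewrite normr_gt0; apply: contraNneq u0 => um; apply/eqP/rowP => i.
  rewrite [RHS]mxE; have := mmax i isT; rewrite /= um normr0 mul0r.
  by rewrite pmulr_lle0 ?invr_gt0 // normr_le0 => /eqP.
apply: le_trans (ler_norm _) _; rewrite -(ler_pM2r um) -normrM.
have -> : eps1 R G * u 0 m = (u *m ecc_mx R G) 0 m by rewrite uA mxE.
have -> : rho * `|u 0 m| = `|u 0 m| / v 0 m * (v *m ecc_mx R G) 0 m.
  by rewrite vA [(_ *: v) 0 m]mxE; move: (v0 m) => vm; field; rewrite gt_eqF.
rewrite [X in `|X|]mxE [X in _ * X]mxE mulr_sumr.
apply: le_trans (ler_norm_sum _ _ _) _; apply: ler_sum => i _.
rewrite normrM (ger0_norm (A0 _ _)) mulrA ler_wpM2r //.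
by rewrite -ler_pdivrMr //; apply: mmax.
Qed.

End Perron.

(* [lam] is the largest root of the monic quadratic polynomial
   [(x - p S') (x - q S) - p q d^2 x]. *)
Definition top_root (R : realType) (d p q S S' lam : R) :=
  [/\ p * S' < lam, q * S < lam &
      (lam - p * S') * (lam - q * S) = p * q * d ^+ 2 * lam].

(** * The largest root of the quadratic equation *)

Section TopRoot.
Variable R : realType.
Implicit Types d p q S lam mu : R.

Lemma top_root_exists d p q S S' :
  0 < d -> 0 < p -> 0 < q -> 0 <= S -> 0 <= S' ->
  exists2 lam, 0 < lam & top_root d p q S S' lam.
Proof.
move=> d0 p0 q0 S0 S'0.
pose a := p * S'; pose b := q * S; pose c := p * q * d ^+ 2.
have a0 : 0 <= a by rewrite mulr_ge0 // ltW.
have b0 : 0 <= b by rewrite mulr_ge0 // ltW.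
have c0 : 0 < c by rewrite !mulr_gt0 // exprn_gt0.
pose t := Num.sqrt ((a + b + c) ^+ 2 - 4 * a * b).
have disc_gt0 : 0 < (a + b + c) ^+ 2 - 4 * a * b.
  have -> : (a + b + c) ^+ 2 - 4 * a * b = (a - b) ^+ 2 + c * (2 * (a + b) + c).
    by ring.
  by rewrite ltr_wpDl ?sqr_ge0 // mulr_gt0 // ltr_wpDl // mulr_ge0 // addr_ge0.
have t2 : t ^+ 2 = (a + b + c) ^+ 2 - 4 * a * b by rewrite sqr_sqrtr ?ltW.
have t0 : 0 < t by rewrite sqrtr_gt0.
(* The root chosen below is [(a + b + c + t) / 2]; its excesses over [a] and [b] are halves of
   expressions of this shape. *)
have H u v : 0 <= u -> 0 <= v -> t ^+ 2 = (u - v + c) ^+ 2 + 4 * c * v ->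
    0 < u - v + c + t.
  move=> u0 v0 E; have [m0|m0] := leP 0 (u - v + c); first by lra.
  have v1 : 0 < v by lra.
  have cv : 0 < c * v by rewrite mulr_gt0.
  have : (- (u - v + c)) ^+ 2 < t ^+ 2 by rewrite E; lra.
  by rewrite ltr_pXn2r ?nnegrE //; lra.
have ha : 0 < b - a + c + t by apply: H => //; rewrite t2; ring.
have hb : 0 < a - b + c + t by apply: H => //; rewrite t2; ring.
exists ((a + b + c + t) / 2); first by rewrite divr_gt0 //; lra.
split; rewrite -?/a -?/b -?/c; [lra|lra|nra].
Qed.

(* The polynomial is increasing beyond its largest root. *)
Lemma top_root_lt d p q S S' lam mu :
  0 < lam -> 0 <= p -> 0 <= q -> 0 <= S -> 0 <= S' ->
  top_root d p q S S' lam ->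
  (mu - p * S') * (mu - q * S) < p * q * d ^+ 2 * mu -> mu < lam.
Proof.
move=> lam0 p0 q0 S0 S'0 [].
have a0 : 0 <= p * S' by rewrite mulr_ge0.
have b0 : 0 <= q * S by rewrite mulr_ge0.
move: (p * S') (q * S) (p * q * d ^+ 2) a0 b0 => a b c a0 b0 al bl E.
apply: contraTT; rewrite -!leNgt => le.
(* From [c * lam = (lam - a) * (lam - b)] and [lam - b <= lam]. At [lam + z] with [z >= 0] the
   polynomial is then at least [z * (lam - b)]. *)
have c_le : c <= lam - a.
  rewrite -(ler_pM2r lam0) -E ler_wpM2l; lra.
have -> : mu = lam + (mu - lam) by ring.
nra.
Qed.

Lemma top_root_le d p q S S' lam mu :
  0 < lam -> 0 <= p -> 0 <= q -> 0 <= S -> 0 <= S' ->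
  top_root d p q S S' lam ->
  (mu - p * S') * (mu - q * S) <= p * q * d ^+ 2 * mu -> mu <= lam.
Proof.
move=> lam0 p0 q0 S0 S'0 [].
have a0 : 0 <= p * S' by rewrite mulr_ge0.
have b0 : 0 <= q * S by rewrite mulr_ge0.
move: (p * S') (q * S) (p * q * d ^+ 2) a0 b0 => a b c a0 b0 al bl E.
apply: contraTT; rewrite -!ltNge => lt.
have c_le : c <= lam - a.
  rewrite -(ler_pM2r lam0) -E ler_wpM2l; lra.
have -> : mu = lam + (mu - lam) by ring.
nra.
Qed.

End TopRoot.

(** * The squared spectral radius as a largest root *)

Section Spectrum.
Variables (R : realType) (G : sgraph) (r : nat).
Variables (par : G -> G) (sd : G -> bool) (h : G -> nat).
Hypotheses (erG : edge_rooted par sd h) (balG : balanced r sd h).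
Implicit Types x y : G.

Definition deep (b : bool) := #|[pred x | (sd x == b) && (h x == r)]|.

Definition weight (b : bool) := (\sum_(x | (sd x == b) && (h x < r)) (h x + r + 1) ^ 2)%N.

Lemma deep_gt0 b : (0 < deep b)%N.
Proof.
by have [x sx hx] := proj2 balG b; apply/card_gt0P; exists x; rewrite inE sx hx !eqxx.
Qed.

(** [X b] is the value of the eigenvector at depth [r] on side [b]. The eigenvalue equation at a
    shallower vertex forces the value there; at depth [r], multiplied by [rho], it becomes the
    hypothesis on [X]. *)
Lemma eps1_eigen (rho : R) (X : bool -> R) :
  0 < rho -> (forall b, 0 < X b) ->
  (forall b, rho ^+ 2 * X b = (deep (~~ b))%:R * r.*2.+1%:R * rho * X (~~ b) +
                              (deep b)%:R * (weight (~~ b))%:R * X b) ->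
  eps1 R G = rho.
Proof.
move=> rho0 X0 XE.
pose w x := if h x == r then X (sd x)
  else (deep (~~ sd x))%:R * (h x + r + 1)%:R * X (~~ sd x) / rho.
apply: (@eps1_positive_vector _ _ w).
- by have [x _ _] := proj2 balG true; apply/card_gt0P; exists x.
- move=> x; rewrite /w; case: ifP => // _.
  by rewrite divr_gt0 // !mulr_gt0 // ltr0n ?deep_gt0 // addn1.
move=> y; have hle x : (h x <= r)%N by have [] := balG.
under eq_bigr => x _ do rewrite (balanced_entry erG balG).
have deepE (c : R) : \sum_(x | (sd x == ~~ sd y) && (h x == r)) c = (deep (~~
  sd y))%:R * c.
  rewrite /deep -sum1_card natr_sum mulr_suml.
  by apply: eq_bigr => x; rewrite mul1r.
have sdE x : (sd x != sd y) = (sd x == ~~ sd y) by case: (sd x); case: (sd y).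
have [hy|hy] := eqVneq (h y) r; last first.
  rewrite {2}/w (negPf hy) [rho * _]mulrC divfK ?gt_eqF //.
  rewrite -mulrA -deepE [RHS]big_mkcond; apply: eq_bigr => x _.
  rewrite orbF sdE /w; case: (sd x =P _) => [sx|_] /=; last by rewrite mulr0.
  case: eqP => [hx|_]; rewrite ?mulr0 // sx mulrC; congr (_%:R * _); lia.
have wy : w y = X (sd y) by rewrite /w hy eqxx.
apply: (mulfI (lt0r_neq0 rho0)); rewrite mulrA -expr2 wy XE.
(* Opposite vertices of depth [r] give the term in [X (~~ sd y)]; substituting the values at
   shallower ones produces [weight]. *)
rewrite (bigID (fun x => (sd x == ~~ sd y) && (h x == r))) /= mulrDr; congr (_ + _).
  rewrite (eq_bigr (fun _ => X (~~ sd y) * r.*2.+1%:R)) => [|x /andP[/eqP sx /eqP hx]].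
    by rewrite deepE; ring.
  by rewrite sdE hy /w hx sx !eqxx /=; congr (_ * _%:R); lia.
rewrite /weight natr_sum mulr_sumr [_%:R * _]mulr_sumr mulr_suml.
rewrite [LHS]big_mkcond [RHS]big_mkcond.
apply: eq_bigr => x _; rewrite sdE hy orbT andbT negb_and.
have [sx|] := eqVneq (sd x) (~~ sd y); rewrite /= ?mulr0 //.
rewrite ltn_neqAle hle andbT; case: ifP => // hx.
rewrite /w (negPf hx) sx negbK natrX; field.
by rewrite gt_eqF.
Qed.

Lemma eps1_top_root :
  0 < eps1 R G /\
  top_root r.*2.+1%:R (deep false)%:R (deep true)%:R (weight false)%:R
    (weight true)%:R (eps1 R G ^+ 2).
Proof.
set d := r.*2.+1%:R; set p := (deep false)%:R; set q := (deep true)%:R.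
set S := (weight false)%:R; set S' := (weight true)%:R.
have d0 : 0 < d :> R by rewrite ltr0n.
have p0 : 0 < p :> R by rewrite ltr0n deep_gt0.
have q0 : 0 < q :> R by rewrite ltr0n deep_gt0.
have [lam lam0 lamP] := top_root_exists d0 p0 q0 (ler0n R _ : 0 <= S) (ler0n R
  _ : 0 <= S').
have rho2 : Num.sqrt lam ^+ 2 = lam by rewrite sqr_sqrtr // ltW.
have rho0 : 0 < Num.sqrt lam by rewrite sqrtr_gt0.
suff -> : eps1 R G = Num.sqrt lam by rewrite rho2.
case: lamP => pl ql E.
(* With these values the equation for [false] is an identity and the one for [true] is the quadratic
   equation [E]. *)
apply: (@eps1_eigen _ (fun b => if b then lam - p * S' else q * d * Num.sqrt lam)) => //.
  by case; rewrite ?subr_gt0 ?mulr_gt0.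
case; rewrite /= rho2 -/p -/q -/d -/S -/S'; last by ring.
move: E rho2; move: (Num.sqrt lam) => s E rho2.
apply/eqP; rewrite -subr_eq0; apply/eqP.
transitivity ((lam - p * S') * (lam - q * S) - p * q * d ^+ 2 * s ^+ 2); first by ring.
by rewrite E rho2 subrr.
Qed.

End Spectrum.

(** * Counting vertices by side and depth *)

(** The weight of a side with a single vertex at each depth below [r]. *)
Definition core r := (\sum_(i < r) (i + r + 1) ^ 2)%N.

Section Levels.
Variables (G : sgraph) (r : nat).
Variables (par : G -> G) (sd : G -> bool) (h : G -> nat).
Hypotheses (erG : edge_rooted par sd h) (balG : balanced r sd h).

Definition level (b : bool) (i : nat) := #|[pred x | (sd x == b) && (h x == i)]|.

(* Each level holds at least one vertex; [excess] counts the others below depth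
   [r]. *)
Definition excess (b : bool) := (\sum_(i < r) (level b i).-1)%N.

(** The ancestors of a vertex of depth [r] meet every level of its side. *)
Lemma level_gt0 b i : (i <= r)%N -> (0 < level b i)%N.
Proof.
move=> ir; have [x sx hx] := proj2 balG b; apply/card_gt0P.
exists (iter (r - i) par x); rewrite inE (er_h_iter erG) (er_sd_iter erG) ?hx
  ?leq_subr //.
by rewrite sx subKn // !eqxx.
Qed.

Lemma level_out b i : (r < i)%N -> level b i = 0%N.
Proof.
move=> ri; apply: eq_card0 => x; rewrite inE; apply/negbTE; rewrite negb_and.
by apply/orP; right; apply: contraTneq ri => <-; rewrite -leqNgt; case: balG.
Qed.

Lemma level_excess b i : (i < r)%N -> level b i = (1 + (level b i).-1)%N.
Proof. by move=> /ltnW /(level_gt0 b); case: (level b i). Qed.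

Lemma excess0_level b i : excess b = 0%N -> (i < r)%N -> level b i = 1%N.
Proof.
move=> /eqP; rewrite sum_nat_eq0 => /forallP e0 ir.
by rewrite level_excess //; have /eqP -> := e0 (Ordinal ir).
Qed.

Lemma sum_level b (f : nat -> nat) :
  (\sum_(x | (sd x == b) && (h x < r)) f (h x) = \sum_(i < r) level b i * f i)%N.
Proof.
rewrite [RHS](eq_bigr (fun i : 'I_r =>
  \sum_(x | (sd x == b) && (h x == i)) f i)%N) => [|i _]; last first.
  by rewrite /level -sum1_card big_distrl; apply: eq_bigr => x _; rewrite /= mul1n.
rewrite (exchange_big_dep (fun x => (sd x == b) && (h x < r)%N)) /=; last first.
  by move=> i x _ /andP[-> /eqP->] /=.
apply: eq_bigr => x /andP[sx hx]; rewrite (big_pred1 (Ordinal hx)) // => i.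
by rewrite sx /= -val_eqE eq_sym.
Qed.

Lemma card_side b : #|[pred x | sd x == b]| = (r + (deep r sd h b + excess b))%N.
Proof.
rewrite -sum1_card (bigID (fun x => h x < r)%N) /=.
have -> : (\sum_(x | (sd x == b) && (h x < r)) 1 = r + excess b)%N.
  rewrite (sum_level b (fun=> 1%N)) -[in RHS](card_ord r) -sum1_card -big_split /=.
  by apply: eq_bigr => i _; rewrite muln1 level_excess.
rewrite addnAC addnA; congr (_ + _ + _)%N; rewrite /deep -sum1_card.
apply: eq_bigl => x; rewrite !inE -leqNgt; congr (_ && _).
by rewrite eqn_leq (proj1 balG).
Qed.

Lemma card_levels :
  #|G| = (r.*2 + (deep r sd h false + excess false) +
          (deep r sd h true + excess true))%N.
Proof.
have <- : (#|[pred x | sd x == true]| + #|[pred x | sd x == false]|)%N = #|G|.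
  rewrite -(cardC [pred x | sd x == true]); congr (_ + _)%N.
  by apply: eq_card => x; rewrite !inE; case: (sd x).
by rewrite !card_side; lia.
Qed.

Lemma weight_levels b :
  weight r sd h b = (core r + \sum_(i < r) (level b i).-1 * (i + r + 1) ^ 2)%N.
Proof.
rewrite /weight (sum_level b (fun i => (i + r + 1) ^ 2)%N) -big_split /=.
by apply: eq_bigr => i _; rewrite {1}level_excess // mulnDl mul1n.
Qed.

Lemma core_le_weight b : (core r <= weight r sd h b)%N.
Proof. by rewrite weight_levels leq_addr. Qed.

Lemma weight_le b : (weight r sd h b <= core r + excess b * r.*2.+1 ^ 2)%N.
Proof.
rewrite weight_levels leq_add2l big_distrl; apply: leq_sum => i _.
by rewrite leq_mul // leq_exp2r //; have := ltn_ord i; lia.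
Qed.

Lemma excess0_weight b : excess b = 0%N -> weight r sd h b = core r.
Proof.
move=> e0; apply/eqP; rewrite eqn_leq core_le_weight andbT.
by have := weight_le b; rewrite e0 addn0.
Qed.

End Levels.

(** * Isomorphisms from level counts *)

(** Corresponding fibres are enumerated in parallel; [g] only supplies the default value of
    [nth]. *)
Lemma fibrewise_inj (A B : finType) (K : eqType) (k : A -> K) (k' : B -> K) :
  (forall c, #|[pred x | k x == c]| = #|[pred y | k' y == c]|) ->
  exists2 f : A -> B, injective f & forall x, k' (f x) = k x.
Proof.
move=> cK; have [g gP] : exists g : A -> B, forall x, k' (g x) == k x.
  apply: (@fin_all_exists _ (fun=> B) (fun x y => k' y == k x)) => x; have : (0
    < #|[pred y | k' y == k x]|)%N.
    by rewrite -cK; apply/card_gt0P; exists x; rewrite inE.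
  by case/card_gt0P=> y; exists y.
pose s c := enum [pred x | k x == c]; pose t c := enum [pred y | k' y == c].
have st c : size (s c) = size (t c) by rewrite -!cardE cK.
have xs x : x \in s (k x) by rewrite mem_enum inE.
pose f x := nth (g x) (t (k x)) (index x (s (k x))).
have fE x : k' (f x) = k x.
  have : f x \in t (k x) by rewrite mem_nth // -st index_mem.
  by rewrite mem_enum inE => /eqP.
exists f => // x y fxy; have kxy : k x = k y by rewrite -!fE fxy.
have ys := xs y; have := xs x; move: fxy; rewrite /f kxy => fxy xs'.
apply: (@index_inj _ x (s (k y))); rewrite ?inE //; apply/eqP.
rewrite -(@nth_uniq _ (g y) (t (k y))) ?enum_uniq -?st ?index_mem //.
by rewrite -fxy; apply/eqP/set_nth_default; rewrite -st index_mem.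
Qed.

Lemma fibrewise_bij (A B : finType) (K : eqType) (k : A -> K) (k' : B -> K) :
  (forall c, #|[pred x | k x == c]| = #|[pred y | k' y == c]|) ->
  exists2 f : A -> B, bijective f & forall x, k' (f x) = k x.
Proof.
move=> cK; have [f fI fE] := fibrewise_inj cK.
have [g gI _] := fibrewise_inj (fun c => esym (cK c)).
by exists f => //; apply: inj_card_bij fI _; apply: leq_card gI.
Qed.

(** Any bijection preserving side and depth works: parents have depth below [r], where levels are
    singletons, so side and depth determine them. At depth 0 this uses [0 < r]. *)
Lemma giso_levels (G H : sgraph) r (par : G -> G) sd h (par' : H -> H) sd' h' :
  (0 < r)%N -> edge_rooted par sd h -> balanced r sd h ->
  edge_rooted par' sd' h' ->
  (forall b i, level sd h b i = level sd' h' b i) ->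
  (forall b i, (i < r)%N -> level sd h b i = 1%N) -> giso G H.
Proof.
move=> r0 erG balG erH lE l1.
have [|f fB fE] := @fibrewise_bij G H _ (fun x => (sd x, h x)) (fun y => (sd' y, h' y)).
  by case=> b i; have := lE b i; rewrite /level.
have fsd x : sd' (f x) = sd x by case: (fE x).
have fh x : h' (f x) = h x by case: (fE x).
have f_par x : par' (f x) = f (par x).
  have hx : ((h x).-1 < r)%N by have := proj1 balG x; lia.
  have := l1 (sd (par x)) _ hx; rewrite lE => /eq_leq/card_le1_eqP.
  by apply; rewrite inE ?(er_sd erH) ?(er_h erH) ?fsd ?fh ?(er_sd erG) ?(er_h erG) !eqxx.
exists f => // u v; rewrite (er_adj erG) (er_adj erH) !f_par.
by rewrite !(inj_eq (bij_inj fB)).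
Qed.

(** Exchanging the sides serves to match a broom whose two ends come in the opposite order. *)
Lemma edge_rooted_swap (G : sgraph) (par : G -> G) sd h :
  edge_rooted par sd h -> edge_rooted par (fun x => ~~ sd x) h.
Proof.
case=> adjE hE sdE rootE; split=> // [x|x y hx hy /negb_inj]; last exact: rootE.
by rewrite sdE addbN.
Qed.

Lemma balanced_swap (G : sgraph) r (sd : G -> bool) h :
  balanced r sd h -> balanced r (fun x => ~~ sd x) h.
Proof.
case=> hle dp; split=> // b; have [x sx hx] := dp (~~ b).
by exists x => //; rewrite sx negbK.
Qed.

Lemma level_swap (G : sgraph) (sd : G -> bool) h b i :
  level (fun x => ~~ sd x) h b i = level sd h (~~ b) i.
Proof. by apply: eq_card => x; rewrite !inE; case: (sd x); case: b. Qed.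

(** * Brooms as balanced edge-rooted trees *)

Section Broom.
Variables (r a b : nat).
Hypothesis r_gt0 : (0 < r)%N.
Local Notation V := (broom r.*2.+1 a b).

(** The root edge is the middle edge of the path, joining vertices [r] and [r.+1]; the pendant
    vertices share depth [r] with the ends of the path. *)
Definition broom_side (x : V) : bool :=
  match x with inl i => (r < i)%N | inr (inl _) => false | inr (inr _) => true end.

Definition broom_depth (x : V) : nat :=
  match x with
  | inl i => if (r < i)%N then (i - r.+1)%N else (r - i)%N
  | inr _ => r
  end.

Definition broom_parent (x : V) : V :=
  match x with
  | inl i => inl (inord (if (r < i)%N then i.-1 else i.+1))
  | inr (inl _) => inl (inord 1)
  | inr (inr _) => inl (inord r.*2)
  end.

Lemma broom_edge_rooted : edge_rooted broom_parent broom_side broom_depth.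
Proof.
have inlE (i j : 'I_r.*2.+2) : (inl i == inl j :> V) = (i == j :> nat) by [].
split.
- move=> [i|[i|i]] [j|[j|j]] //=; rewrite ?inlE ?orbF ?inordK //=;
    have ? := ltn_ord i; have ? := ltn_ord j; do ?case: ifP => ?; lia.
- move=> [i|[i|i]] /=; last 2 first.
  + by rewrite inordK; do ?case: ifP => ?; lia.
  + by rewrite inordK; do ?case: ifP => ?; lia.
  by have ? := ltn_ord i; case: (ltnP r i) => ?; rewrite inordK; do ?case: ifP => ?; lia.
- move=> [i|[i|i]] /=; last 2 first.
  + by rewrite inordK; lia.
  + by rewrite inordK; lia.
  by have ? := ltn_ord i; case: (ltnP r i) => ?; rewrite inordK; lia.
- move=> [i|[i|i]] [j|[j|j]] //=; do ?case: ifP => ?; try lia.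
    by move=> hi hj _; congr inl; apply: val_inj => /=; lia.
  by move=> hi hj _; congr inl; apply: val_inj => /=; lia.
Qed.

Lemma broom_balanced : balanced r broom_side broom_depth.
Proof.
split=> [[i|[i|i]]|[]] //=; first by have := ltn_ord i; case: ifP; lia.
  by exists (inl ord_max) => /=; do ?case: ifP; lia.
by exists (inl ord0) => /=; lia.
Qed.

Lemma broom_level s i : (i <= r)%N ->
  level broom_side broom_depth s i = (1 + (i == r) * (if s then b else a))%N.
Proof.
move=> ir; rewrite /level -sum1_card big_sumType big_sumType /=.
rewrite (big_pred1 (inord (if s then i + r.+1 else r - i)%N)) => [|j]; last first.
  rewrite !inE /= -val_eqE /= inordK; last by case: s; lia.
  by have := ltn_ord j; case: s; case: ifP => /=; lia.
congr (_ + _)%N; rewrite (eq_bigl (fun=> (s == false) && (i == r))); last first.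
  by move=> j; rewrite !inE /= eq_sym [r == i]eq_sym.
rewrite addnC (eq_bigl (fun=> (s == true) && (i == r))); last first.
  by move=> j; rewrite !inE /= eq_sym [r == i]eq_sym.
by case: s; case: (i == r); rewrite /= ?big_pred0_eq ?sum1_card ?card_ord
  ?mul1n ?mul0n ?addn0 ?add0n.
Qed.

Lemma broom_excess s : excess r broom_side broom_depth s = 0%N.
Proof.
apply: big1 => i _; rewrite broom_level ?(ltnW (ltn_ord i)) //.
by rewrite (ltn_eqF (ltn_ord i)).
Qed.

Lemma broom_deep s : deep r broom_side broom_depth s = (if s then b else a).+1.
Proof. by have := broom_level s (leqnn r); rewrite eqxx mul1n. Qed.

Lemma card_broom : #|V| = (r.*2 + a.+1 + b.+1)%N.
Proof.
by rewrite (card_levels broom_edge_rooted broom_balanced) !broom_deep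
  !broom_excess !addn0.
Qed.

Lemma broom_is_tree : is_tree V.
Proof.
by split; [exact: er_connected broom_edge_rooted|exact: er_acyclic broom_edge_rooted].
Qed.

End Broom.

Lemma giso_broom (G : sgraph) r (par : G -> G) sd h a b :
  (0 < r)%N -> edge_rooted par sd h -> balanced r sd h ->
  (forall s, excess r sd h s = 0%N) ->
  deep r sd h false = a.+1 -> deep r sd h true = b.+1 ->
  giso G (broom r.*2.+1 a b).
Proof.
move=> r0 erG balG ex0 da db.
apply: (giso_levels r0 erG balG (broom_edge_rooted a b r0)) => [s i|s i ir]; last first.
  exact: (excess0_level erG balG).
have [ir|ri|->] := ltngtP i r.
- by rewrite (excess0_level erG balG) // broom_level ?(ltnW ir) // (ltn_eqF ir).
- by rewrite (level_out balG) // (level_out (broom_balanced a b r0)).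
- by rewrite broom_level // eqxx mul1n; case: s; [exact: db|exact: da].
Qed.

(** * Monotonicity of the largest root *)

Section Compare.
Variable R : realType.
Implicit Types d p q s x y lam mu : R.

Lemma top_root_sym d p q S S' lam : top_root d p q S S' lam -> top_root d q p S' S lam.
Proof. by case=> pl ql E; split=> //; rewrite mulrC E [q * p]mulrC. Qed.

(* The left-hand side minus the right-hand side is at most
   [- x S' (lam - q S)], because [(lam - p S') q e <= lam q x d^2]. *)
Lemma move_deeper d p q S S' e x lam :
  0 < lam -> 0 <= p -> 0 < q -> 0 < S' -> 0 <= x -> 0 <= e <= x * d ^+ 2 ->
  top_root d p q S S' lam ->
  (lam - (p + x) * S') * (lam - q * (S - e)) <= (p + x) * q * d ^+ 2 * lam
    ?= iff (x == 0).
Proof.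
move=> lam0 p0 q0 S'0 x0 /andP[e0 ex] [pl ql E].
have [xz|xz] := eqVneq x 0.
  have ez : e = 0 by apply/eqP; rewrite eq_le e0 andbT (le_trans ex) // xz mul0r.
  by rewrite xz ez addr0 subr0 E; split; rewrite ?eqxx.
have {xz} xgt0 : 0 < x by rewrite lt_def xz.
suff lt : (lam - (p + x) * S') * (lam - q * (S - e)) < (p + x) * q * d ^+ 2 * lam.
  by split; [exact: ltW|rewrite lt_eqF].
rewrite -subr_lt0.
have -> : (lam - (p + x) * S') * (lam - q * (S - e)) - (p + x) * q * d ^+ 2 * lam =
  (lam - p * S') * (lam - q * S) - p * q * d ^+ 2 * lam
  - (q * lam * (x * d ^+ 2 - e) + p * S' * q * e + x * S' * (lam - q * S)
     + x * S' * q * e) by ring.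
rewrite E subrr sub0r oppr_lt0.
have t1 : 0 <= q * lam * (x * d ^+ 2 - e).
  by rewrite mulr_ge0 ?subr_ge0 // mulr_ge0 ?ltW.
have t2 : 0 <= p * S' * q * e.
  by rewrite !mulr_ge0 // ltW.
have t3 : 0 < x * S' * (lam - q * S) by rewrite !mulr_gt0 // subr_gt0.
have t4 : 0 <= x * S' * q * e by rewrite mulr_ge0 // !mulr_ge0 // ltW.
lra.
Qed.

(** By [move_deeper] with [e = S - s], the polynomial of [mu] is nonpositive at [lam], and negative
    if [0 < x]. *)
Lemma move_deeper_le d p q s S S' x lam mu :
  0 < lam -> 0 < mu -> 0 <= p -> 0 < q -> 0 < S' -> 0 <= x -> 0 <= s ->
  s <= S <= s + x * d ^+ 2 ->
  top_root d p q S S' lam -> top_root d (p + x) q s S' mu ->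
  lam <= mu /\ (0 < x -> lam < mu).
Proof.
move=> lam0 mu0 p0 q0 S'0 x0 s0 /andP[sS Ss] tl tm.
have e0 : 0 <= S - s <= x * d ^+ 2 by rewrite subr_ge0 sS lerBlDl.
have [le eq] := move_deeper lam0 p0 q0 S'0 x0 e0 tl.
have sE : S - (S - s) = s by ring.
rewrite sE in le eq; have px : 0 <= p + x by rewrite addr_ge0.
split; first by apply: top_root_le tm _ => //; exact: ltW.
move=> xgt0; apply: top_root_lt tm _ => //; try exact: ltW.
by rewrite lt_neqAle le andbT eq gt_eqF.
Qed.

Lemma all_deeper d p q s S S' x y lam mu :
  0 < d -> 0 < lam -> 0 < mu -> 0 < p -> 0 < q -> 0 < s -> 0 <= x -> 0 <= y ->
  s <= S <= s + x * d ^+ 2 -> s <= S' <= s + y * d ^+ 2 ->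
  top_root d p q S S' lam -> top_root d (p + x) (q + y) s s mu ->
  lam <= mu /\ (0 < x \/ 0 < y -> lam < mu).
Proof.
move=> d0 lam0 mu0 p0 q0 s0 x0 y0 Sx S'y tl tm.
have S'0 : 0 < S' by apply: lt_le_trans s0 _; case/andP: S'y.
have px0 : 0 < p + x by rewrite ltr_pwDl.
(* The intermediate root [nu] arises when only the first side has been cleared. *)
have [nu nu0 tn] := top_root_exists d0 px0 q0 (ltW s0) (ltW S'0).
have [le1 lt1] := move_deeper_le lam0 nu0 (ltW p0) q0 S'0 x0 (ltW s0) Sx tl tn.
have [le2 lt2] := move_deeper_le nu0 mu0 (ltW q0) px0 s0 y0 (ltW s0) S'y
  (top_root_sym tn) (top_root_sym tm).
split; first exact: le_trans le1 le2.
by case=> [/lt1 lt|/lt2 lt]; [exact: lt_le_trans lt le2|exact: le_lt_trans le1 lt].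
Qed.

(** For equal sums, the second polynomial evaluated at the root [lam] of the first is exactly the
    product assumed nonpositive. *)
Lemma same_sum_le d p q p' q' s lam lam' :
  0 < lam' -> 0 <= p' -> 0 <= q' -> 0 <= s -> p + q = p' + q' ->
  top_root d p q s s lam -> top_root d p' q' s s lam' ->
  (p * q - p' * q') * (d ^+ 2 * lam - s ^+ 2) <= 0 ->
  lam <= lam' /\ ((p * q - p' * q') * (d ^+ 2 * lam - s ^+ 2) < 0 -> lam < lam').
Proof.
move=> lam'0 p'0 q'0 s0 sumE [_ _ E] tl'.
have -> : (p * q - p' * q') * (d ^+ 2 * lam - s ^+ 2) =
    (lam - p' * s) * (lam - q' * s) - p' * q' * d ^+ 2 * lam.
  apply/eqP; rewrite -subr_eq0; apply/eqP.
  transitivity (p * q * d ^+ 2 * lam - (lam - p * s) * (lam - q * s)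
     + s * lam * (p' + q' - (p + q))); first by ring.
  by rewrite sumE E; ring.
rewrite subr_le0 subr_lt0 => le.
by split=> [|lt]; [apply: top_root_le tl' _|apply: top_root_lt tl' _].
Qed.

End Compare.

(** * Arithmetic of sums of squares and of products *)

(** The second summand on the left is six times the sum of the first [m] squares, which avoids
    subtraction. *)
Lemma sum_squares k m :
  (6 * (\sum_(i < k) (i + m + 1) ^ 2) + m * (m + 1) * (m.*2 + 1) =
   (m + k) * (m + k + 1) * ((m + k).*2 + 1))%N.
Proof.
elim: k => [|k IH]; first by rewrite big_ord0; lia.
by rewrite big_ord_recr /= mulnDr addnAC IH; lia.
Qed.

Lemma coreE r : (6 * core r = r * (r.*2 + 1) * (7 * r + 1))%N.
Proof. by have := sum_squares r r; rewrite -/(core r); lia. Qed.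

Lemma core_gt0 r : (0 < r)%N -> (0 < core r)%N.
Proof. by move=> r0; have := coreE r; nia. Qed.

(* As [4 r (7 r + 1) = (2 r + 1) (14 r - 5) + 5], equality would force [2 r + 1]
   to divide [5], hence [r = 2] and [N = 1]. *)
Lemma core_neq r N : (0 < r)%N -> (1 < N)%N -> core r <> (N * r.*2.+1 ^ 2)%N.
Proof.
move=> r0 N1 E; have := coreE r; rewrite E => E6.
have E1 : (6 * N * (r.*2 + 1) = r * (7 * r + 1))%N.
  apply/eqP; rewrite -(eqn_pmul2r (_ : 0 < r.*2 + 1)%N) ?addn1 //.
  by apply/eqP; move: E6; rewrite addn1; lia.
have dvd5 : (r.*2.+1 %| 5)%N.
  rewrite -(dvdn_addr 5 (dvdn_mull (14 * r) (dvdnn r.*2.+1))).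
  have -> : (14 * r * r.*2.+1 + 5 = (24 * N + 5) * r.*2.+1)%N by lia.
  exact: dvdn_mull.
have := dvdn_leq (isT : 0 < 5)%N dvd5.
by case: r r0 {E E6} E1 dvd5 => [|[|[|r]]] //=; lia.
Qed.

Lemma sum_prod_eq (p q a b : nat) :
  (p + q = a + b -> p * q = a * b -> (p == a) || (p == b))%N.
Proof.
move=> sumE prodE; have [pa|ap] := leqP p a.
  pose k := (a - p)%N; have aE : a = (p + k)%N by rewrite subnKC.
  have qE : q = (b + k)%N by lia.
  move: prodE; rewrite qE {1}aE mulnDl mulnDr => /addnI/eqP.
  rewrite mulnC eqn_mul2l => /orP[/eqP k0|->]; last by rewrite orbT.
  by rewrite aE k0 addn0 eqxx.
pose k := (p - a)%N; have pE : p = (a + k)%N by rewrite subnKC // ltnW.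
have bE : b = (q + k)%N by lia.
move: prodE; rewrite {1}pE bE mulnDl mulnDr => /addnI/eqP.
rewrite [X in _ == X]mulnC eqn_mul2l => /orP[/eqP k0|/eqP qa]; last by lia.
by rewrite pE k0 addn0 eqxx.
Qed.

Lemma prod_le_balanced (p q x y : nat) :
  (p + q = x + y -> x <= y <= x.+1 -> p * q <= x * y)%N.
Proof.
wlog pq : p q / (p <= q)%N => [wl|] sumE xy.
  have [/wl|/ltnW qp] := leqP p q; first exact.
  by rewrite mulnC wl // addnC.
(* Here [p <= x] because [2 p <= x + y <= 2 x + 1]. *)
pose t := (x - p)%N; have xE : x = (p + t)%N by rewrite subnKC //; lia.
have -> : q = (y + t)%N by lia.
rewrite {1}xE mulnDl mulnDr leq_add2l mulnC leq_mul2l; apply/orP; right; lia.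
Qed.

(** * Comparing a tree with a broom *)

Section BroomBound.
Variables (R : realType) (r : nat) (G : sgraph).
Variables (par : G -> G) (sd : G -> bool) (h : G -> nat).
Hypotheses (r0 : (0 < r)%N) (erG : edge_rooted par sd h) (balG : balanced r sd h).

Let P s := (deep r sd h s + excess r sd h s)%N.

(* [mu] is the square of the spectral radius of the broom obtained from [G] by
   moving all superfluous inner vertices of each side to depth [r]. *)
Lemma broom_bound a b (mu : R) :
  (P false + P true = a.+1 + b.+1)%N -> 0 < mu ->
  top_root r.*2.+1%:R (P false)%:R (P true)%:R (core r)%:R (core r)%:R mu ->
  ((P false * P true)%:R - (a.+1 * b.+1)%:R)
    * (r.*2.+1%:R ^+ 2 * mu - (core r)%:R ^+ 2) <= 0 ->
  r.*2.+1%:R ^+ 2 * mu != (core r)%:R ^+ 2 ->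
  eps1 R G <= eps1 R (broom r.*2.+1 a b) /\
  (eps1 R G = eps1 R (broom r.*2.+1 a b) -> giso G (broom r.*2.+1 a b)).
Proof.
move=> sumP mu0 tm le0 ne.
have [eG0 tG] := eps1_top_root R erG balG.
have [eD0 tD] := eps1_top_root R (broom_edge_rooted a b r0) (broom_balanced a b r0).
set eG := eps1 R G in eG0 tG *; set eD := eps1 R (broom _ _ _) in eD0 tD *.
rewrite !(broom_deep _ _ r0) in tD.
rewrite !(excess0_weight (broom_edge_rooted a b r0) (broom_balanced a b r0)
           (broom_excess _ _ r0 _)) in tD.
have core0 : 0 < (core r)%:R :> R by rewrite ltr0n core_gt0.
have wP s : (core r)%:R <= ((weight r sd h s)%:R : R) <=
    (core r)%:R + (excess r sd h s)%:R * r.*2.+1%:R ^+ 2.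
  rewrite ler_nat (core_le_weight erG balG) -natrX -natrM -natrD ler_nat.
  exact: (weight_le erG balG).
have deep0 s : 0 < (deep r sd h s)%:R :> R by rewrite ltr0n (deep_gt0 balG).
have eG20 : 0 < eG ^+ 2 by rewrite exprn_gt0.
have eD20 : 0 < eD ^+ 2 by rewrite exprn_gt0.
have d0 : 0 < r.*2.+1%:R :> R by rewrite ltr0n.
have tm' := tm; rewrite /P !natrD in tm'.
have [le1 lt1] := all_deeper d0 eG20 mu0 (deep0 false) (deep0 true) core0
  (ler0n _ _) (ler0n _ _) (wP false) (wP true) tG tm'.
have sumR : (P false)%:R + (P true)%:R = a.+1%:R + b.+1%:R :> R.
  by rewrite -!natrD sumP.
rewrite !natrM in le0.
have [le2 lt2] := same_sum_le eD20 (ler0n _ _) (ler0n _ _) (ltW core0) sumR tm tD le0.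
have le12 : eG ^+ 2 <= eD ^+ 2 by exact: le_trans le1 le2.
split; first by move: le12; rewrite ler_pXn2r // nnegrE ltW.
move=> eGD.
have exc0 s : excess r sd h s = 0%N.
  apply/eqP; rewrite -leqn0 leqNgt; apply/negP => ex.
  suff : eG ^+ 2 < eD ^+ 2 by rewrite eGD ltxx.
  by apply: lt_le_trans (lt1 _) le2; rewrite !ltr0n; case: s ex; [right|left].
have prodE : (P false * P true = a.+1 * b.+1)%N.
  apply/eqP; rewrite -(eqr_nat R) !natrM; apply/negPn/negP => neP.
  suff : eG ^+ 2 < eD ^+ 2 by rewrite eGD ltxx.
  apply: le_lt_trans le1 (lt2 _); rewrite lt_neqAle le0 andbT.
  by rewrite mulf_eq0 !subr_eq0 negb_or neP.
move: sumP prodE; rewrite /P !exc0 !addn0 => sumP prodE.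
have := sum_prod_eq sumP prodE.
case/orP=> /eqP df.
  by apply: (giso_broom r0 erG balG exc0) => //; move: sumP; rewrite df => /addnI.
(* The counts match the broom in reverse order, so the sides of [G] are exchanged. *)
have dt : deep r sd h true = a.+1.
  by move: sumP; rewrite df addnC => /addIn.
apply: (giso_broom r0 (edge_rooted_swap erG) (balanced_swap balG)) => [s||].
- by rewrite -(exc0 (~~ s)); apply: eq_bigr => i _; rewrite level_swap.
- by rewrite -dt; exact: level_swap.
- by rewrite -df; exact: level_swap.
Qed.

End BroomBound.

(** * The choice of the extremal broom *)

(** The inequality attached to the second alternative is kept because it fails for [r = 1], which
    settles diameter 3. *)
Lemma broom_maximal (R : realType) (r : nat) (G : sgraph) :
  (0 < r)%N -> is_tree G -> diam G = r.*2.+1 ->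
  let m := (#|G| - r.*2.+2)%N in
  let D0 := broom r.*2.+1 0 m in
  let D1 := broom r.*2.+1 m./2 (uphalf m) in
  (eps1 R G <= eps1 R D1 /\ (eps1 R G = eps1 R D1 -> giso G D1)) \/
  (r.*2.+1 ^ 2 < core r)%N /\
  (eps1 R G <= eps1 R D0 /\ (eps1 R G = eps1 R D0 -> giso G D0)).
Proof.
move=> r0 treeG dG m D0 D1.
have [par [sd [h [erG balG]]]] := odd_diam_tree treeG dG.
set d : R := r.*2.+1%:R; set s : R := (core r)%:R.
pose P t := (deep r sd h t + excess r sd h t)%N.
have P0 t : (0 < P t)%N by rewrite ltn_addr // (deep_gt0 balG).
have cardG : #|G| = (r.*2 + P false + P true)%N := card_levels erG balG.
have mE : (P false + P true = m.+2)%N by have := P0 false; have := P0 true; lia.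
have d0 : 0 < d by rewrite ltr0n.
have s0 : 0 < s by rewrite ltr0n core_gt0.
have PR t : 0 < (P t)%:R :> R by rewrite ltr0n.
have [mu mu0 tm] := top_root_exists d0 (PR false) (PR true) (ltW s0) (ltW s0).
(* Equality would reduce the quadratic equation to [mu = m.+2 * s], hence [s = m.+2 * d ^+ 2],
   against [core_neq]. *)
have ne : d ^+ 2 * mu != s ^+ 2.
  apply/eqP => E; apply: (@core_neq r (m.+2)) => //; apply/eqP.
  rewrite -(eqr_nat R) natrM natrX -mE natrD -/d -/s.
  case: tm => _ _ Em.
  have : mu * (mu - ((P false)%:R + (P true)%:R) * s) = 0.
    transitivity ((mu - (P false)%:R * s) * (mu - (P true)%:R * s)
      - (P false)%:R * (P true)%:R * s ^+ 2); first by ring.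
    by rewrite Em -E; ring.
  move/eqP; rewrite mulf_eq0 gt_eqF //= subr_eq0 => /eqP muE.
  rewrite -(inj_eq (mulIf (lt0r_neq0 s0))) -expr2 -E {1}muE; apply/eqP; ring.
have uh : (m./2 + uphalf m = m)%N by rewrite uphalf_half addnCA addnn odd_double_half.
have [lt|gt] : d ^+ 2 * mu < s ^+ 2 \/ s ^+ 2 < d ^+ 2 * mu.
  by move: ne; case: ltgtP; [left|right|].
  right; split.
    have [pl _ _] := tm.
    (* Together with [d ^+ 2 * mu < s ^+ 2] this gives [d ^+ 2 < s]. *)
    have muS : s <= mu.
      by apply: le_trans (ltW pl); rewrite ler_peMl ?ler1n // ltW.
    rewrite -(ltr_nat R) natrX -/d -/s -(ltr_pM2r s0) -expr2; apply: le_lt_trans lt.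
    by rewrite ler_wpM2l // ?exprn_ge0 ?ltW.
  apply: (broom_bound r0 erG balG (mu := mu)) => //.
  rewrite -/(P false) -/(P true); apply: mulr_ge0_le0; last by rewrite subr_le0 ltW.
  rewrite subr_ge0 ler_nat.
  have [p pE] : exists p, P false = p.+1 by exists (P false).-1; have := P0 false; lia.
  have [q qE] : exists q, P true = q.+1 by exists (P true).-1; have := P0 true; lia.
  by rewrite mul1n pE qE mulSn mulnS; lia.
left; apply: (broom_bound r0 erG balG (mu := mu)) => //.
  by rewrite addSn addnS uh; exact: mE.
rewrite -/(P false) -/(P true); apply: mulr_le0_ge0; last by rewrite subr_ge0 ltW.
rewrite subr_le0 ler_nat.
apply: prod_le_balanced; first by lia.
by rewrite uphalf_half; case: (odd m); lia.
Qed.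

Theorem theorem2p6 (R : realType) :
  (forall (n d : nat) (T : sgraph),
     odd d -> (3 <= d)%N -> is_tree T -> #|T| = n -> diam T = d ->
     let D0 := broom d 0 (n - d - 1) in
     let D1 := broom d (n - d - 1)./2 (uphalf (n - d - 1)) in
     eps1 R T <= Num.max (eps1 R D0) (eps1 R D1) /\
     (eps1 R T = Num.max (eps1 R D0) (eps1 R D1) -> giso T D0 \/ giso T D1)) /\
  (forall n : nat, (4 <= n)%N ->
     let D := broom 3 (n - 4)./2 (uphalf (n - 4)) in
     [/\ is_tree D, #|D| = n, diam D = 3%N &
       forall T : sgraph, is_tree T -> #|T| = n -> diam T = 3%N ->
         eps1 R T <= eps1 R D /\ (eps1 R T = eps1 R D -> giso T D)]).
Proof.
split=> [n d T odd_d d3 treeT cardT diamT D0 D1|n n4 D].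
  have [r r0 dE] : exists2 r, (0 < r)%N & d = r.*2.+1 by exists d./2; lia.
  have mE : (n - d - 1)%N = (#|T| - r.*2.+2)%N by lia.
  rewrite dE in diamT; have := broom_maximal R r0 treeT diamT.
  rewrite /= -mE -dE -/D0 -/D1 => -[|[_]] [le iso].
    split=> [|eqM]; first by rewrite le_max le orbT.
    by right; apply: iso; apply/eqP; rewrite eq_le le eqM le_max lexx orbT.
  split=> [|eqM]; first by rewrite le_max le.
  by left; apply: iso; apply/eqP; rewrite eq_le le eqM le_max lexx.
have r0 : (0 < 1)%N by [].
split=> [|||T treeT cardT diamT].
- exact: (@broom_is_tree 1).
- by rewrite (card_broom _ _ r0) uphalf_half; have := odd_double_half (n - 4); lia.
- exact: balanced_diam (broom_edge_rooted _ _ r0) (broom_balanced _ _ r0).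
have := broom_maximal R r0 treeT diamT; rewrite /= cardT -/D => -[//|[lt _]].
(* [core 1] is 4, which is below 9. *)
by have := coreE 1; lia.
Qed.
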